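(* Consider student $i\in N$ with utility function $u_i$ generated by the student preference generator described in the context, a price vector $p\in\mathbb R^m_+$, and a budget $b_i\in[1,1+\beta]$, $\beta>0$. The individual student utility optimization problem $$\arg\max_{\{x\in\Psi_i:\ x\cdot p\le b_i\}}u_i(x)$$ can be equivalently formulated as the following mixed integer program (MIP): $$\arg\max_{x\in\Psi_i}\ \sum_{c\in M_c}\sum_{j\in C_c}\sum_{\tau=1}^{\bar\tau}\psi_c(\tau)\,G_{c,j,\tau}\,u_i(\{j\})+\sum_{c\in M_c}\sum_{j\in S_c}\sum_{\tau=1}^{\bar\tau}\xi_c(\tau)\,J_{c,j,\tau}\,u_i(\{j\})+\sum_{j=1}^m x_j\,u_i(\{j\})$$ subject to $$\sum_{\tau=1}^{\bar\tau}\tau\,G_{c,j',\tau}\le\sum_{j\in C_c}x_j\quad\forall j'\in C_c,\ \forall c\in M_c,$$ $$\sum_{\tau=1}^{\bar\tau}G_{c,j,\tau}\le 1\quad\forall j\in C_c,\ \forall c\in M_c,$$ $$\sum_{\tau=1}^{\bar\tau}\tau\,J_{c,j',\tau}\ge\sum_{j\in S_c}x_j\quad\forall j'\in S_c,\ \forall c\in M_c,$$ $$\sum_{\tau=1}^{\bar\tau}J_{c,j,\tau}\le 1\quad\forall j\in S_c,\ \forall c\in M_c,$$ $$\sum_{j=1}^m p_jx_j\le b_i .$$ Here $\bar\tau$ is the maximum number of courses in a schedule; $G_{c,j,\tau}$ is the binary variable denoting whether or not course $j$, which belongs to the set of complementarities $C_c$, is in $x$ while in total $\tau$ courses from that set are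 included in $x$; and $J_{c,j,\tau}$ is the binary variable denoting whether or not course $j$, which belongs to the set of substitutabilities $S_c$, is in $x$ while in total $\tau$ courses from that set are included in $x$.
   Context: $N$ is the set of students. $M$ is a set of $m$ courses (indexed by $1,\dots,m$), viewed as points in $\mathbb N^2$. A schedule is $x\in\mathcal X=\{0,1\}^m$, identified with the set of courses $\{j:x_j=1\}$. $\Psi_i$ is the set of permissible schedules of student $i$ (encoding eligibility and time-slot constraints). Student preference generator: $M_p\subseteq M$ is the set of popular courses and $M_c\subseteq M_p$ is a set of centers. For a center $c\in M_c$ and radii $r_s,r_c\in\mathbb N_{>0}$, the set of substitutabilities is $S_c=\{j\in M: L_1(j,c)\le r_s\}$ and the set of complementarities is $C_c=(\{j\in M: L_\infty(j,c)\le r_c\}\setminus S_c)\cup\{c\}$, where $L_1$ and $L_\infty$ are the corresponding distances. For each center $c$, $\psi_c:\{0,\dots,|C_c|\}\to\mathbb R_+$ and $\xi_c:\{0,\dots,|S_c|\}\to\mathbb R_-$ are piecewise constant step functions giving the multiplicative bonus, respectively penalty, factors for the number of courses taken from $C_c$, respectively $S_c$; $\psi_c$ is monotonically non-decreasing and $\xi_c$ is monotonically non-increasing. $u_i(\{j\})$ denotes student $i$'s base value for course $j$ (drawn from a uniform distribution on an interval of nonnegative reals). With $\tau_c(x)=|\{j\in x: j\in C_c\}|$ and $\kappa_c(x)=|\{j\in x: j\in S_c\}|$, the utility function $u_i:\mathcal X\to\mathbb R_+$ of student $i$ is $$u_i(x)=\sum_{j\in x}u_i(\{j\})+\sum_{c\in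 M_c}\sum_{j\in C_c}\psi_c(\tau_c(x))\,u_i(\{j\})+\sum_{c\in M_c}\sum_{j\in S_c}\xi_c(\kappa_c(x))\,u_i(\{j\}),$$ where on the right-hand side $u_i(\{j\})$ stands for the base values.
   Formalization: Added assumption: ψ_c(0)=0 and ξ_c(0)=0 for every center c (the MIP sums start at τ=1, so the claim fails otherwise); where the MIP evaluates ψ_c, ξ_c beyond |C_c|, |S_c|, they are continued by their last value. *)

(* Defs.v *)
From mathcomp Require Import all_boot all_order all_algebra.

Set Implicit Arguments.
Unset Strict Implicit.
Unset Printing Implicit Defensive.

Import Order.TTheory GRing.Theory Num.Theory.
Local Open Scope ring_scope.

Definition is_argmax (R : realFieldType) (T : Type) (D : T -> Prop)
  (f : T -> R) (t : T) : Prop :=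
  D t /\ forall t', D t' -> f t' <= f t.

Definition L1 (a b : nat * nat) : nat :=
  (`|a.1 - b.1| + `|a.2 - b.2|)%N.

Definition Linf (a b : nat * nat) : nat :=
  maxn `|a.1 - b.1|%N `|a.2 - b.2|%N.

(* The m courses are the ordinals 'I_m; [pos] places them in the grid. *)
Definition substitutes (m : nat) (pos : 'I_m -> nat * nat) (rs : nat)
  (c : 'I_m) : {set 'I_m} :=
  [set j | L1 (pos j) (pos c) <= rs]%N.

Definition complements (m : nat) (pos : 'I_m -> nat * nat) (rs rc : nat)
  (c : 'I_m) : {set 'I_m} :=
  ([set j | (Linf (pos j) (pos c) <= rc)%N] :\: substitutes pos rs c)
  :|: [set c].

Definition schedule (m : nat) := {ffun 'I_m -> bool}.

Definition courses (m : nat) (x : schedule m) : {set 'I_m} := [set j | x j].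

(* tau_c (x) for A = C_c, kappa_c (x) for A = S_c. *)
Definition count_in (m : nat) (A : {set 'I_m}) (x : schedule m) : nat :=
  #|courses x :&: A|.

Definition max_courses (m : nat) (Psi : {set schedule m}) : nat :=
  \max_(x in Psi) #|courses x|.

(* A real function on {0, ..., n} is given by f : nat -> R whose values above n
   are irrelevant. Where a formula evaluates it above n, it is continued by
   its last constant value f n. *)
Definition step_ext (R : realFieldType) (n : nat) (f : nat -> R) (t : nat) : R :=
  f (minn t n).

(* In [utility] and the programs below, C and S are the families of
   complementarities and substitutabilities, v the base values. *)
Definition utility (R : realFieldType) (m : nat) (Mc : {set 'I_m})
  (C S : 'I_m -> {set 'I_m}) (psi xi : 'I_m -> nat -> R) (v : 'I_m -> R)
  (x : schedule m) : R :=
  \sum_(j in courses x) v j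
  + \sum_(c in Mc) \sum_(j in C c) psi c (count_in (C c) x) * v j
  + \sum_(c in Mc) \sum_(j in S c) xi c (count_in (S c) x) * v j.

Definition affordable (R : realFieldType) (m : nat) (Psi : {set schedule m})
  (p : 'I_m -> R) (b : R) (x : schedule m) : Prop :=
  x \in Psi /\ \sum_(j < m) (x j)%:R * p j <= b.

(* Only the entries c \in Mc, j \in C c (resp. S c), 1 <= t <= max_courses of
   mip_G (resp. mip_J) occur in the program; the others are inert. *)
Record mip_point (m : nat) := MipPoint {
  mip_x : schedule m;
  mip_G : 'I_m -> 'I_m -> nat -> bool;
  mip_J : 'I_m -> 'I_m -> nat -> bool }.

Definition mip_feasible (R : realFieldType) (m : nat) (Mc : {set 'I_m})
  (C S : 'I_m -> {set 'I_m}) (Psi : {set schedule m}) (p : 'I_m -> R) (b : R)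
  (z : mip_point m) : Prop :=
  let x := mip_x z in
  let G := mip_G z in
  let J := mip_J z in
  let tbar := max_courses Psi in
  x \in Psi /\
  (forall c, c \in Mc -> forall j', j' \in C c ->
     (\sum_(1 <= t < tbar.+1) t * G c j' t <= \sum_(j in C c) x j)%N) /\
  (forall c, c \in Mc -> forall j, j \in C c ->
     (\sum_(1 <= t < tbar.+1) G c j t <= 1)%N) /\
  (forall c, c \in Mc -> forall j', j' \in S c ->
     (\sum_(1 <= t < tbar.+1) t * J c j' t >= \sum_(j in S c) x j)%N) /\
  (forall c, c \in Mc -> forall j, j \in S c ->
     (\sum_(1 <= t < tbar.+1) J c j t <= 1)%N) /\
  \sum_(j < m) p j * (x j)%:R <= b.

Definition mip_objective (R : realFieldType) (m : nat) (Mc : {set 'I_m})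
  (C S : 'I_m -> {set 'I_m}) (psi xi : 'I_m -> nat -> R) (v : 'I_m -> R)
  (Psi : {set schedule m}) (z : mip_point m) : R :=
  let tbar := max_courses Psi in
  \sum_(c in Mc) \sum_(j in C c) \sum_(1 <= t < tbar.+1)
     step_ext #|C c| (psi c) t * (mip_G z c j t)%:R * v j
  + \sum_(c in Mc) \sum_(j in S c) \sum_(1 <= t < tbar.+1)
     step_ext #|S c| (xi c) t * (mip_J z c j t)%:R * v j
  + \sum_(j < m) (mip_x z j)%:R * v j.

(* Main.v *)
(** For a fixed schedule, the constraints on [G c j] and [J c j] say that at most
    one level is selected, and that the selected level (0 if there is none) is at
    most, resp. at least, the number of courses taken from [C c], resp. [S c].
    Since [psi c] is non-decreasing, [xi c] is non-increasing and the base values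
    are nonnegative, the best choice is to select exactly this number, which turns
    the MIP objective into the utility. *)

Require Import Defs.
From mathcomp Require Import all_boot all_order all_algebra.

Set Implicit Arguments.
Unset Strict Implicit.
Unset Printing Implicit Defensive.

Import Order.TTheory GRing.Theory Num.Theory.
Local Open Scope ring_scope.

(** The value [g z] never beats [f] at the projection and is matched exactly at lifts, so both
    problems have the same upper bounds, and maximizers transfer in both directions. *)
Lemma argmax_lift (R : realFieldType) (T Z : Type) (D : T -> Prop)
  (E : Z -> Prop) (f : T -> R) (g : Z -> R) (proj : Z -> T) (lift : T -> Z) :
  (forall z, E z -> D (proj z)) -> (forall x, D x -> E (lift x)) ->
  (forall z, E z -> g z <= f (proj z)) -> (forall x, D x -> g (lift x) = f x) ->
  (forall x, is_argmax D f x -> is_argmax E g (lift x)) /\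
  (forall z, is_argmax E g z ->
     is_argmax D f (proj z) /\ g z = f (proj z)).
Proof.
move=> ED DE gf fg; split=> [x [Dx xmax]|z [Ez zmax]].
  split=> [|z Ez]; first exact: DE.
  by rewrite fg //; apply: le_trans (gf z Ez) (xmax _ (ED z Ez)).
(* The lift of [x] competes with [z]. At [x = proj z] this is the converse of [gf]. *)
have fz x : D x -> f x <= g z by move=> Dx; rewrite -fg //; apply/zmax/DE.
split; last by apply/eqP; rewrite eq_le gf //= fz //; apply: ED.
split=> [|x Dx]; first exact: ED.
by apply: le_trans (fz x Dx) (gf z Ez).
Qed.

(** At most one [t] is selected, and the sum on the right is that [t], or 0 if there is none; the
    latter case is where [f 0 = 0] enters. *)
Lemma sum_selected (R : pzRingType) (f : nat -> R) (g : nat -> bool) (n : nat) :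
  f 0%N = 0 -> (\sum_(1 <= t < n.+1) g t <= 1)%N ->
  \sum_(1 <= t < n.+1) f t * (g t)%:R = f (\sum_(1 <= t < n.+1) t * g t)%N.
Proof.
move=> f0; elim: n => [|n IHn]; first by rewrite !big_geq.
rewrite !(big_nat_recr n.+1) //=; case gn: (g n.+1); last first.
  by rewrite mulr0 !addr0 muln0 !addn0; apply: IHn.
(* The top level is selected, so the bound 1 leaves nothing for the lower ones. *)
rewrite addn1 ltnS leqn0 => /eqP g0.
have {}g0 t : (1 <= t < n.+1)%N -> g t = false.
  move=> tn; apply/negbTE; rewrite -eqb0.
  move/eqP: g0; rewrite sum_nat_seq_eq0 => /allP/(_ t).
  by rewrite mem_index_iota tn => /(_ isT).
rewrite big_nat big1 => [|t /g0 ->]; last by rewrite mulr0.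
rewrite [in RHS]big_nat big1 => [|t /g0 ->]; last by rewrite muln0.
by rewrite add0r add0n mulr1 muln1.
Qed.

(** For [k = 0] no index of the range matches, and the sum is still [k]. *)
Lemma sum_level (n k : nat) : (k <= n)%N ->
  (\sum_(1 <= t < n.+1) t * (t == k) = k)%N.
Proof.
move=> kn; under eq_bigr do rewrite mulnbr.
by rewrite -big_mkcond big_nat1_eq ltnS kn andbT; case: k {kn}.
Qed.

Lemma sum_level_le1 (n k : nat) : (\sum_(1 <= t < n.+1) (t == k) <= 1)%N.
Proof.
under eq_bigr do rewrite -(mul1n (nat_of_bool _)) mulnbr.
by rewrite -big_mkcond big_nat1_eq; case: ifP.
Qed.

Lemma count_inE (m : nat) (A : {set 'I_m}) (x : schedule m) :
  (\sum_(j in A) x j = count_in A x)%N.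
Proof.
rewrite /count_in -sum1_card big_mkcond [RHS]big_mkcond.
by apply: eq_bigr => j _; rewrite !inE andbC; case: (j \in A); case: (x j).
Qed.

Lemma count_in_le (m : nat) (A : {set 'I_m}) (x : schedule m) :
  (count_in A x <= #|A|)%N.
Proof. exact/subset_leq_card/subsetIr. Qed.

Lemma count_in_le_max_courses (m : nat) (A : {set 'I_m})
  (Psi : {set schedule m}) (x : schedule m) :
  x \in Psi -> (count_in A x <= max_courses Psi)%N.
Proof.
move=> xPsi; apply: leq_trans (subset_leq_card (subsetIl _ _)) _.
exact: leq_bigmax_cond.
Qed.

Lemma step_ext_le (R : realFieldType) (n : nat) (f : nat -> R) (s k : nat) :
  (forall k l, (k <= l <= n)%N -> f k <= f l) -> (s <= k <= n)%N ->
  step_ext n f s <= f k.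
Proof.
move=> fmono /andP[sk kn]; apply: fmono.
by rewrite kn andbT geq_min sk.
Qed.

(** Here [s] may exceed [n]: capping it at [n] returns it to the domain of monotonicity, and keeps
    it above [k] because [k <= n]. *)
Lemma step_ext_ge (R : realFieldType) (n : nat) (f : nat -> R) (s k : nat) :
  (forall k l, (k <= l <= n)%N -> f l <= f k) -> (k <= s)%N -> (k <= n)%N ->
  step_ext n f s <= f k.
Proof. by move=> fmono ks kn; apply: fmono; rewrite leq_min ks kn geq_minr. Qed.

Lemma step_ext_id (R : realFieldType) (n : nat) (f : nat -> R) (k : nat) :
  (k <= n)%N -> step_ext n f k = f k.
Proof. by move=> kn; rewrite /step_ext (minn_idPl kn). Qed.

(** The level is independent of the course and is selected even for courses outside [x], since
    [utility] applies the factors to all of [C c] and [S c]. *)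
Definition level_point (m : nat) (C S : 'I_m -> {set 'I_m}) (x : schedule m) :
  mip_point m :=
  MipPoint x (fun c _ t => t == count_in (C c) x)
             (fun c _ t => t == count_in (S c) x).

Lemma sum_courses (R : realFieldType) (m : nat) (v : 'I_m -> R)
  (x : schedule m) :
  \sum_(j in courses x) v j = \sum_(j < m) (x j)%:R * v j.
Proof.
rewrite big_mkcond; apply: eq_bigr => j _; rewrite inE.
by case: (x j); rewrite ?mul1r ?mul0r.
Qed.

Section Program.

Variables (R : realFieldType) (m : nat) (Mc : {set 'I_m}).
Variables (C S : 'I_m -> {set 'I_m}) (psi xi : 'I_m -> nat -> R).
Variables (v p : 'I_m -> R) (b : R) (Psi : {set schedule m}).

Let u := utility Mc C S psi xi v.
Let obj := mip_objective Mc C S psi xi v Psi.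
Let feasible := mip_feasible Mc C S Psi p b.

Lemma affordable_mip_x (z : mip_point m) :
  feasible z -> affordable Psi p b (mip_x z).
Proof.
move=> [xPsi [_ [_ [_ [_ cost]]]]]; split=> //.
by under eq_bigr do rewrite mulrC.
Qed.

Lemma feasible_level_point (x : schedule m) :
  affordable Psi p b x -> feasible (level_point C S x).
Proof.
move=> [xPsi cost]; split=> //=.
split=> [c _ j _|]; first by rewrite count_inE sum_level ?count_in_le_max_courses.
split=> [c _ j _|]; first exact: sum_level_le1.
split=> [c _ j _|]; first by rewrite count_inE sum_level ?count_in_le_max_courses.
split=> [c _ j _|]; first exact: sum_level_le1.
by under eq_bigr do rewrite mulrC.
Qed.

Hypothesis psi0 : forall c, c \in Mc -> psi c 0%N = 0.
Hypothesis xi0 : forall c, c \in Mc -> xi c 0%N = 0.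

(** The program has no level 0; [psi0] and [xi0] allow an empty selection to be read as level 0. *)
Lemma mip_objectiveE (z : mip_point m) : feasible z ->
  obj z = \sum_(j in courses (mip_x z)) v j
  + \sum_(c in Mc) \sum_(j in C c) step_ext #|C c| (psi c)
      (\sum_(1 <= t < (max_courses Psi).+1) t * mip_G z c j t)%N * v j
  + \sum_(c in Mc) \sum_(j in S c) step_ext #|S c| (xi c)
      (\sum_(1 <= t < (max_courses Psi).+1) t * mip_J z c j t)%N * v j.
Proof.
move=> [_ [_ [G1 [_ [J1 _]]]]].
(* The base values move to the last place, as in the program. *)
rewrite sum_courses -addrA addrC; congr (_ + _ + _).
  apply: eq_bigr => c cM; apply: eq_bigr => j jC.
  by rewrite -mulr_suml sum_selected ?G1 // /step_ext min0n psi0.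
apply: eq_bigr => c cM; apply: eq_bigr => j jS.
by rewrite -mulr_suml sum_selected ?J1 // /step_ext min0n xi0.
Qed.

(** The count is at most both [max_courses Psi] and the size of the family, so neither the range of
    levels nor the cap in [step_ext] alters it. *)
Lemma mip_objective_level_point (x : schedule m) :
  affordable Psi p b x -> obj (level_point C S x) = u x.
Proof.
move=> xP; rewrite mip_objectiveE; last exact: feasible_level_point.
case: xP => xPsi _; congr (_ + _ + _);
  apply: eq_bigr => c _; apply: eq_bigr => j _;
  by rewrite sum_level ?count_in_le_max_courses // step_ext_id ?count_in_le.
Qed.

Hypothesis psi_mono : forall c, c \in Mc -> forall k l,
  (k <= l <= #|C c|)%N -> psi c k <= psi c l.
Hypothesis xi_mono : forall c, c \in Mc -> forall k l,
  (k <= l <= #|S c|)%N -> xi c l <= xi c k.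
Hypothesis v_ge0 : forall j, 0 <= v j.

Lemma mip_objective_le_utility (z : mip_point m) :
  feasible z -> obj z <= u (mip_x z).
Proof.
move=> zF; rewrite mip_objectiveE //.
case: zF => _ [Gle [_ [Jge _]]]; apply: lerD; first apply: lerD => //.
  apply: ler_sum => c cM; apply: ler_sum => j jC; apply: ler_wpM2r => //.
  apply: step_ext_le; first exact: psi_mono.
  by rewrite count_in_le -count_inE Gle.
apply: ler_sum => c cM; apply: ler_sum => j jS; apply: ler_wpM2r => //.
apply: step_ext_ge; [exact: xi_mono | | exact: count_in_le].
by rewrite -count_inE Jge.
Qed.

End Program.

(** [G] and [J] are existential because an optimal schedule need not determine them: where [psi c]
    is constant, a lower level can be equally good. *)
Theorem mainTheorem4 (R : realFieldType) (N : finType) (m : nat)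
  (pos : 'I_m -> nat * nat) (pos_inj : injective pos)
  (Mp Mc : {set 'I_m}) (McMp : Mc \subset Mp)
  (rs rc : nat) (rs_gt0 : (0 < rs)%N) (rc_gt0 : (0 < rc)%N)
  (psi xi : 'I_m -> nat -> R)
  (psi_ge0 : forall c, c \in Mc -> forall k,
     (k <= #|complements pos rs rc c|)%N -> 0 <= psi c k)
  (psi_mono : forall c, c \in Mc -> forall k l,
     (k <= l <= #|complements pos rs rc c|)%N -> psi c k <= psi c l)
  (psi0 : forall c, c \in Mc -> psi c 0%N = 0)
  (xi_le0 : forall c, c \in Mc -> forall k,
     (k <= #|substitutes pos rs c|)%N -> xi c k <= 0)
  (xi_mono : forall c, c \in Mc -> forall k l,
     (k <= l <= #|substitutes pos rs c|)%N -> xi c l <= xi c k)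
  (xi0 : forall c, c \in Mc -> xi c 0%N = 0)
  (Psi : N -> {set schedule m})
  (v : N -> 'I_m -> R) (v_ge0 : forall k j, 0 <= v k j)
  (p : 'I_m -> R) (p_ge0 : forall j, 0 <= p j)
  (beta : R) (beta_gt0 : 0 < beta)
  (b : N -> R) (b_range : forall k, 1 <= b k <= 1 + beta)
  (i : N) :
  let C := complements pos rs rc in
  let S := substitutes pos rs in
  let u := utility Mc C S psi xi (v i) in
  let optimal := is_argmax (affordable (Psi i) p (b i)) u in
  let mip_obj := mip_objective Mc C S psi xi (v i) (Psi i) in
  let mip_optimal := is_argmax (mip_feasible Mc C S (Psi i) p (b i)) mip_obj in
  (forall x : schedule m,
     optimal x <-> exists G J, mip_optimal (MipPoint x G J)) /\
  (forall z : mip_point m, mip_optimal z -> mip_obj z = u (mip_x z)).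
Proof.
move=> C S u optimal mip_obj mip_optimal.
have [lift_opt proj_opt] :
    (forall x, optimal x -> mip_optimal (level_point C S x)) /\
    (forall z, mip_optimal z -> optimal (mip_x z) /\ mip_obj z = u (mip_x z)).
  apply: argmax_lift.
  - exact: affordable_mip_x.
  - exact: feasible_level_point.
  - exact: mip_objective_le_utility.
  - exact: mip_objective_level_point.
split=> [x|z /proj_opt[]//]; split=> [/lift_opt|[G [J /proj_opt[]//]]].
(* These are the variables of [level_point C S x]. *)
by exists (fun c _ t => t == count_in (C c) x),
          (fun c _ t => t == count_in (S c) x).
Qed.
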